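(* Let $T$ be a finite tree with at least two vertices and let $C$ be a configuration on $T$. If $S_v(C)\le0$ for all $v\in V(T)$, then $$|C|\le\operatorname{estim}(T)-1.$$
   Context: Graphs are finite, simple and undirected; a tree is a nonempty connected acyclic graph; $\mathbb N$ includes $0$; $u\sim v$ denotes adjacency. A configuration on $T$ is a function $C:V(T)\to\mathbb N$; its mass is $|C|=\sum_vC(v)$. Estimator. With $d_T$ the graph distance, put $$\ell_T(r)=|\{v\ne r:\deg_T(v)=1\}|,\qquad \sigma_T(r)=1+\sum_{\substack{v\in V(T)\\ v=r\text{ or }\deg_T(v)>1}}\deg_T(v)\,2^{d_T(r,v)},$$ $$E_T(r)=\sigma_T(r)+\ell_T(r),\qquad \operatorname{estim}(T)=\max_{r\in V(T)}E_T(r).$$ Messages and scores. For adjacent $v,p$ let $B_{v\mid p}$ be the component containing $v$ after deleting the edge $vp$. It is occupied (with respect to $C$) if $C$ is not identically zero on it, and empty otherwise. Define $F:\mathbb Z\to\mathbb Z$ by $F(x)=2x-3$ for $x\le1$; $F(x)=x/2$ for even $x\ge2$; $F(x)=(x-3)/2$ for odd $x\ge3$. For an occupied branch $B_{v\mid p}$ define recursively the integer message $$d_{v\to p}=F\Bigl(C(v)+\sum_{\substack{u\sim v,\ u\ne p\\ B_{u\mid v}\text{ occupied}}}d_{u\to v}\Bigr).$$ Put $\bar d_{v\to p}=d_{v\to p}$ if $B_{v\mid p}$ is occupied and $\bar d_{v\to p}=0$ if it is empty. The score at $v$ is $$S_v(C)=C(v)+\sum_{u\sim v}\bar d_{u\to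 v}.$$ *)

(* Defs.v *)
From mathcomp Require Import all_boot all_order all_algebra.
Set Implicit Arguments.
Unset Strict Implicit.
Unset Printing Implicit Defensive.
Import Order.TTheory GRing.Theory Num.Theory.
Local Open Scope nat_scope.

Definition simple_graph (T : finType) (e : rel T) : Prop :=
  symmetric e /\ irreflexive e.

(* For a symmetric irreflexive relation, the uniq closed walks with at most
   two vertices are exactly the non-cycles (empty walk, back-and-forth along
   an edge), so acyclicity says that there is no longer one. *)
Definition acyclic (T : finType) (e : rel T) : Prop :=
  forall c : seq T, ucycle e c -> size c <= 2.

Definition is_tree (T : finType) (e : rel T) : Prop :=
  [/\ simple_graph e, 0 < #|T|, forall x y : T, connect e x y & acyclic e].

Definition deg (T : finType) (e : rel T) (v : T) : nat := #|[set u | e v u]|.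

(* Least length of a walk from x to y; the junk value #|T| is taken only when
   x and y are not connected. *)
Definition dist (T : finType) (e : rel T) (x y : T) : nat :=
  find (fun n => [exists p : n.-tuple T, path e x p && (last x p == y)])
       (iota 0 #|T|).

Definition ell (T : finType) (e : rel T) (r : T) : nat :=
  #|[set v | (v != r) && (deg e v == 1)]|.

Definition sigma (T : finType) (e : rel T) (r : T) : nat :=
  1 + \sum_(v : T | (v == r) || (1 < deg e v)) deg e v * 2 ^ dist e r v.

Definition estim_at (T : finType) (e : rel T) (r : T) : nat :=
  sigma e r + ell e r.

Definition estim (T : finType) (e : rel T) : nat := \max_(r : T) estim_at e r.

Definition mass (T : finType) (C : T -> nat) : nat := \sum_(v : T) C v.

Definition del_edge (T : finType) (e : rel T) (v p : T) : rel T :=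
  [rel x y | e x y && ((x, y) != (v, p)) && ((x, y) != (p, v))].

Definition branch (T : finType) (e : rel T) (v p : T) : {set T} :=
  [set w | connect (del_edge e v p) v w].

Definition occupied (T : finType) (e : rel T) (C : T -> nat) (v p : T) : bool :=
  [exists w in branch e v p, C w != 0].

Local Open Scope ring_scope.

Definition F (x : int) : int :=
  if x <= 1 then 2 * x - 3
  else if (2 %| x)%Z then (x %/ 2)%Z
  else ((x - 3) %/ 2)%Z.

Fixpoint message_fuel (T : finType) (e : rel T) (C : T -> nat) (n : nat)
    (v p : T) : int :=
  if n is n'.+1 then
    F ((C v)%:Z + \sum_(u : T | [&& e v u, u != p & occupied e C u v])
                    message_fuel e C n' u v)
  else 0.

(* In a tree the recursion depth never exceeds #|T|; message_rec below gives
   the recursive equation satisfied by message. *)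
Definition message (T : finType) (e : rel T) (C : T -> nat) (v p : T) : int :=
  message_fuel e C #|T| v p.

Definition message_bar (T : finType) (e : rel T) (C : T -> nat) (v p : T) : int :=
  if occupied e C v p then message e C v p else 0.

Definition score (T : finType) (e : rel T) (C : T -> nat) (v : T) : int :=
  (C v)%:Z + \sum_(u : T | e v u) message_bar e C u v.

Lemma branch_self (T : finType) (e : rel T) (v p : T) : v \in branch e v p.
Proof. by rewrite inE connect0. Qed.

Lemma branch_notin (T : finType) (e : rel T) (v p : T) :
  is_tree e -> e v p -> p \notin branch e v p.
Proof.
move=> [[esym eirr] _ _ acy] evp; rewrite inE; apply/negP => /connectP [q0 q0P lq0].
case/shortenP: q0P lq0 => q qP uq _ lq.
have eq : path e v q by apply: sub_path qP => x y /andP [/andP []].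
have := acy (v :: q); rewrite /ucycle /= rcons_path eq -lq esym evp /=.
move/(_ uq); case: q qP lq {uq eq} => [|a [|b q]] //=.
- by move=> _ ?; subst p; rewrite eirr in evp.
- by move=> + pa; rewrite pa /del_edge /= eqxx andbF.
Qed.

Lemma branch_proper (T : finType) (e : rel T) (v p u : T) :
  is_tree e -> e v p -> e v u -> u != p -> branch e u v \proper branch e v p.
Proof.
move=> tre evp evu up; have [[esym eirr] _ _ _] := tre.
have vN : v \notin branch e u v by apply: branch_notin => //; rewrite esym.
apply/properP; split; last by exists v; rewrite ?branch_self.
apply/subsetP => w; rewrite !inE => /connectP [q qP ->].
apply: (@connect_trans _ _ u).
  apply: connect1; rewrite /del_edge /= evu !xpair_eqE eqxx /= up /=.
  by apply/negP => /andP [_ /eqP uv]; rewrite uv eirr in evu.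
apply/connectP; exists q => //.
apply: (@sub_in_path _ (mem (branch e u v))) (qP).
  move=> x y xB yB /andP [/andP [exy _] _]; rewrite /del_edge /= exy !xpair_eqE.
  by apply/andP; split; apply/negP => /andP [/eqP E1 /eqP E2]; subst;
    first [rewrite xB in vN | rewrite yB in vN].
apply/allP => x /predU1P [->|xq]; first exact: branch_self.
suff: x \in branch e u v by [].
by rewrite inE; apply: (path_connect qP); apply/orP; right; exact: xq.
Qed.

Lemma message_fuel_stable (T : finType) (e : rel T) (C : T -> nat) (m n : nat)
    (v p : T) :
  is_tree e -> e v p -> (#|branch e v p| <= m)%N -> (#|branch e v p| <= n)%N ->
  message_fuel e C m v p = message_fuel e C n v p.
Proof.
move=> tre; have [[esym _] _ _ _] := tre.
have B0 x y : (0 < #|branch e x y|)%N.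
  by apply/card_gt0P; exists x; exact: branch_self.
elim: m n v p => [|m IH] [|n] v p evp lm ln;
  try by move: (B0 v p); rewrite ltnNge ?lm ?ln.
congr (F (_ + _)) => /=; apply: eq_bigr => u /and3P [evu up _].
have lt := proper_card (branch_proper tre evp evu up).
by apply: IH; rewrite ?(esym u) // -ltnS; apply: leq_trans lt _.
Qed.

Lemma message_rec (T : finType) (e : rel T) (C : T -> nat) (v p : T) :
  is_tree e -> e v p ->
  message e C v p =
  F ((C v)%:Z + \sum_(u : T | [&& e v u, u != p & occupied e C u v])
                  message e C u v).
Proof.
move=> tre evp; have [[esym _] _ _ _] := tre.
rewrite /message (@message_fuel_stable _ _ _ _ #|T|.+1) ?max_card //; last first.
  exact: leqW (max_card _).
Qed.

(* Main.v *)
Require Import Defs.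
From mathcomp Require Import all_boot all_order all_algebra.
From mathcomp Require Import zify lra.
Set Implicit Arguments.
Unset Strict Implicit.
Unset Printing Implicit Defensive.
Import Order.TTheory GRing.Theory Num.Theory.
Local Open Scope ring_scope.

(** Replace the rule [F] by its concave minorant
    [phi x = min (2 * x - 3) ((x - 3) / 2)] over the rationals, treat every
    branch as occupied, and put one unit on every empty leaf.  Together these
    changes do not raise the score at a vertex that carries mass, and the mass
    does not drop ([cscore_pad_le]); so, the zero configuration being trivial,
    it suffices to bound the mass of a configuration [C] that is at least 1 on leaves and whose concave score is
    nonpositive at some vertex [r].  Three facts do it.

    - The concave score at [r] is a concave function of [C], being composed
      of sums and of the increasing concave [phi].  The configurations of
      given mass that are at least 1 on leaves form a simplex, whose vertices
      put one unit on each leaf and the whole remaining mass [m] on a single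
      vertex [w].  A concave function that is nonpositive somewhere on a
      simplex is nonpositive at one of its vertices ([exists_pile]).

    - The map [x |-> - phi x] is an involution, and it is decreasing, so
      the inequality [x + phi y <= 0] is symmetric in [x] and [y].  Hence the
      sign condition on the score moves along edges, and the score of the
      pile configuration is nonpositive at [w] itself ([cscore_reroot]).

    - At [w] the score is the content of [w] plus the messages of the
      branches around it, and a branch whose leaves are filled sends at least
      [- cost].  The costs around [w] add up to less than [sigma e w]
      ([sum_cost_lt_sigma]), so the total mass is at most
      [estim_at e w - 1] ([pile_bound]). *)

(** * Branches and distances *)

Section Tree.
Variables (T : finType) (e : rel T).
Hypothesis treP : is_tree e.

Let esym : symmetric e. Proof. by case: treP => [[]]. Qed.
Let conn x y : connect e x y. Proof. by case: treP. Qed.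

(** Induction from the leaves inwards, the scheme of all recursions on
    messages: it is well founded because the branches behind [v] are properly
    contained in the branch of [v]. *)
Lemma branch_ind (P : T -> T -> Prop) :
  (forall v p, e v p -> (forall u, e v u -> u != p -> P u v) -> P v p) ->
  forall v p, e v p -> P v p.
Proof.
move=> IHP v p; have [n] := ubnP #|branch e v p|.
elim: n v p => // n IHn v p ltn evp; apply: IHP => // u evu up.
apply: IHn; last by rewrite esym.
exact: leq_trans (proper_card (branch_proper treP evp evu up)) _.
Qed.

Lemma branch_sub v p u :
  e v p -> e v u -> u != p -> branch e u v \subset branch e v p.
Proof. by move=> evp evu up; rewrite proper_sub // branch_proper. Qed.

Lemma branch_opp_disjoint v p x :
  e v p -> x \in branch e v p -> x \notin branch e p v.
Proof.
move=> evp; rewrite !inE => vx; apply/negP => px.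
have del_sym : symmetric (del_edge e v p).
  by move=> a b; rewrite /del_edge /= esym !xpair_eqE;
     case: (e b a); rewrite //= andbC (andbC (b == v)) (andbC (b == p)).
have px' : connect (del_edge e v p) p x.
  rewrite (eq_connect (e' := del_edge e p v)) // => a b.
  by rewrite /del_edge /= -!andbA [(_ != _) && _]andbC.
have := branch_notin treP evp; rewrite inE => /negP; apply.
by apply: connect_trans vx _; rewrite (sym_connect_sym del_sym).
Qed.

(** Branches at distinct neighbors of [v] are disjoint: seen from [u], the
    branch of another neighbor [u'] lies beyond the edge to [v]. *)
Lemma branch_inj v u u' x :
  e v u -> e v u' -> x \in branch e u v -> x \in branch e u' v -> u = u'.
Proof.
move=> evu evu' xu xu'; apply/eqP/negP => /negP uu'.
have evu0 : e u v by rewrite esym.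
have := branch_opp_disjoint evu0 xu; rewrite (subsetP _ _ xu') //.
by apply: branch_sub; rewrite // eq_sym.
Qed.

Lemma leaf_neighbor v p q : deg e v = 1%N -> e v p -> e v q -> p = q.
Proof.
move=> /eqP/cards1P [r Nv].
have nbr z : e v z -> z = r by move=> evz; apply/set1P; rewrite -Nv inE.
by move=> /nbr -> /nbr ->.
Qed.

Lemma leaf_branch v p x :
  e v p -> deg e v = 1%N -> x \in branch e v p -> x = v.
Proof.
move=> evp dv; rewrite inE => /connectP [[|y s] //= /andP[vy _] _].
move: vy => /andP[/andP[evy + _]].
by rewrite (leaf_neighbor dv evy evp) eqxx.
Qed.

(** When [s] is so long that its size is not tested in the definition of
    [dist], the bound is the junk value. *)
Lemma dist_le x s : path e x s -> (dist e x (last x s) <= size s)%N.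
Proof.
move=> ps; have [lt|ge] := ltnP (size s) #|T|; last first.
  by apply: leq_trans (find_size _ _) _; rewrite size_iota.
rewrite leqNgt; apply/negP => /(before_find 0%N).
rewrite nth_iota // add0n => /existsP; apply.
by exists (in_tuple s); rewrite /= ps eqxx.
Qed.

Lemma dist_uniq_path x y :
  exists s, [/\ path e x s, last x s = y, uniq (x :: s) &
                (size s <= dist e x y)%N].
Proof.
pose A n := [exists p : n.-tuple T, path e x p && (last x p == y)].
have hasA : has A (iota 0 #|T|).
  case/connectP: (conn x y) => s0 ps0 ly.
  case/shortenP: ps0 ly => s ps us _ ly.
  apply/hasP; exists (size s).
    rewrite mem_iota add0n /=; have := max_card (mem (x :: s)).
    by rewrite (card_uniqP us).
  by apply/existsP; exists (in_tuple s); rewrite /= ps ly eqxx.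
have := nth_find 0%N hasA; move: (hasA); rewrite has_find size_iota => lt.
rewrite nth_iota // add0n => /existsP [t /andP[]].
case/shortenP => s ps us sub /eqP ls; exists s; split=> //.
rewrite -[X in (_ <= X)%N](size_tuple t); apply: uniq_leq_size => //.
by case/andP: us.
Qed.

(** A shortest walk from [v] to a point of the branch of [u] leaves [v] once
    and for all, hence by the edge to [u]. *)
Lemma dist_branch v u x :
  e v u -> x \in branch e u v -> (dist e u x < dist e v x)%N.
Proof.
move=> evu xu; have euv : e u v by rewrite esym.
have [[|u' s] [/= ps ls us le]] := dist_uniq_path v x.
  by move: (branch_notin treP euv); rewrite [X in X \notin _]ls xu.
case/andP: ps => evu' ps; apply: leq_ltn_trans le.
have vNs : v \notin u' :: s by case/andP: us.
have ->: u = u'.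
  apply: branch_inj evu evu' xu _; rewrite inE; apply/connectP; exists s => //.
  apply: (@sub_in_path _ (mem (u' :: s))) (ps); last by apply/allP => z.
  move=> a b aB bB eab; rewrite /del_edge /= eab !xpair_eqE /=.
  by apply/andP; split; apply/negP => /andP [/eqP E1 /eqP E2]; subst;
    [move: bB | move: aB]; rewrite /= (negbTE vNs).
by rewrite -ls; exact: dist_le.
Qed.

(** * The cost of emptying a branch *)

(** The opposite of the message sent by a branch with one unit on each leaf
    and nothing elsewhere.  That message obeys the recursion
    [cost = 3 + 2 * (sum of the costs of the children)], with value 1 at a
    leaf; the closed form is the share of the branch in [sigma]. *)
Definition cost (v p : T) : nat :=
  1 + \sum_(x in branch e v p | (1 < deg e x)%N) deg e x * 2 ^ (dist e v x).+1.

Lemma sum_branches_le (v : T) (P : pred T) (A : {set T}) (f : T -> nat) :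
  (forall u, P u -> e v u /\ branch e u v \subset A) ->
  (\sum_(u | P u) \sum_(x in branch e u v) f x <= \sum_(x in A :\ v) f x)%N.
Proof.
move=> PA; rewrite (exchange_big_dep (mem (A :\ v))) /=; last first.
  move=> u x /PA [evu BA] xu; rewrite in_setD1 (subsetP BA) // andbT.
  have euv : e u v by rewrite esym.
  by apply: contraTneq xu => ->; exact: branch_notin.
apply: leq_sum => x _; rewrite sum_nat_const -{2}[f x]mul1n leq_mul2r.
apply/orP; right; apply/card_le1_eqP => u u'.
rewrite -!topredE /= => /andP[/PA [evu _] xu] /andP[/PA [evu' _] xu'].
exact: (@branch_inj v _ _ x).
Qed.

Lemma sum_cost_le (v : T) (P : pred T) (A : {set T}) :
  (forall u, P u -> e v u /\ branch e u v \subset A) ->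
  (\sum_(u | P u) cost u v <=
   #|P| + \sum_(x in A :\ v | 1 < deg e x) deg e x * 2 ^ dist e v x)%N.
Proof.
move=> PA; rewrite -sum1_card big_split leq_add2l [leqRHS]big_mkcondr.
apply: leq_trans (sum_branches_le _ PA); apply: leq_sum => u /PA [evu _].
rewrite -big_mkcondr; apply: leq_sum => x /andP[xu _].
by rewrite leq_mul2l leq_exp2l // dist_branch ?orbT.
Qed.

(** The term of [v] in the closed form is at least [2 * deg e v]; this pays for
    the constant 2 and for a 2 per child, as [v] has [deg e v - 1] children. *)
Lemma cost_step v p : e v p -> (1 < deg e v)%N ->
  (3 + 2 * \sum_(u | e v u && (u != p)) cost u v <= cost v p)%N.
Proof.
move=> evp dv.
have cardP : deg e v = (#|[pred u | e v u && (u != p)]|).+1.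
  rewrite /deg (cardsD1 p) inE evp add1n; congr _.+1.
  by apply: eq_card => u; rewrite !inE andbC.
have sub u : e v u && (u != p) -> e v u /\ branch e u v \subset branch e v p.
  by move=> /andP[evu up]; split; rewrite // branch_sub.
have := @sum_cost_le v [pred u | e v u && (u != p)] (branch e v p) sub.
rewrite /=; set S1 := (\sum_(u | _) _)%N.
set S2 := (\sum_(x in _ | _) _)%N => S1_le.
rewrite /cost (bigD1 v) ?branch_self //=; set S3 := (\sum_(x | _) _)%N.
have -> : S3 = (2 * S2)%N.
  rewrite /S3 /S2 big_distrr /=; apply: eq_big => [x|x _].
    by rewrite in_setD1 andbC andbA.
  by rewrite expnS mulnCA.
have : (deg e v <= deg e v * 2 ^ dist e v v)%N by rewrite leq_pmulr ?expn_gt0.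
rewrite expnS; set t := (deg e v * 2 ^ _)%N; rewrite mulnCA -/t.
have : (S1 < deg e v + S2)%N by rewrite cardP addSn ltnS.
move: (deg e v) t S1 S2 {cardP dv S1_le} => d t S1 S2; lia.
Qed.

Lemma sum_cost_lt_sigma w : (\sum_(u | e w u) cost u w < sigma e w)%N.
Proof.
have /(_ _)/leq_ltn_trans : _ := @sum_cost_le w (e w) [set: T] _; apply.
  by move=> u ewu; split; rewrite // subsetT.
rewrite /sigma add1n ltnS [leqRHS](bigD1 w) ?eqxx //= leq_add //.
  by rewrite /deg cardsE -[leqLHS]muln1 leq_mul2l expn_gt0 orbT.
rewrite big_mkcond [leqRHS]big_mkcond /=; apply: leq_sum => x _.
by rewrite !inE andbT; case: eqVneq => //= _; rewrite andbT.
Qed.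

(** * Concave messages *)

Definition phi (x : rat) : rat := Num.min (2 * x - 3) ((x - 3) / 2).

Lemma phi_mono x y : x <= y -> phi x <= phi y.
Proof. by move=> xy; rewrite /phi !minEle; do 2?case: ifP; lra. Qed.

Lemma phi_low x : x <= 1 -> phi x = 2 * x - 3.
Proof. by move=> x1; apply/min_idPl; lra. Qed.

Lemma phi_le_F (x : rat) (n : int) : x <= n%:~R -> phi x <= (F n)%:~R.
Proof.
move=> xn; apply: le_trans (phi_mono xn) _; rewrite /phi /F ge_min.
case: (leP n 1) => n1; first by rewrite rmorphB rmorphM /= lexx.
apply/orP; right; rewrite ler_pdivrMr //.
set f := (if _ then _ else _); have : n - 3 <= f * 2 by rewrite /f; case: ifP; lia.
by rewrite -(ler_int rat) rmorphB rmorphM.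
Qed.

(** Both conditions say [y <= - phi x], since the decreasing map [- phi] is
    its own inverse. *)
Lemma phi_swap x y : x + phi y <= 0 -> y + phi x <= 0.
Proof. by rewrite /phi !minEle; do 2?case: ifP; lra. Qed.

(** Jensen's inequality; [phi] is a minimum of two affine functions. *)
Lemma phi_concave (I : finType) (a x : I -> rat) :
  (forall i, 0 <= a i) -> \sum_i a i = 1 ->
  \sum_i a i * phi (x i) <= phi (\sum_i a i * x i).
Proof.
move=> a0 a1; rewrite /phi le_min; apply/andP; split.
  have -> : 2 * (\sum_i a i * x i) - 3 = \sum_i a i * (2 * x i - 3).
    under [RHS]eq_bigr do rewrite mulrBr mulrCA.
    by rewrite sumrB -mulr_suml -mulr_sumr a1 mul1r.
  by apply: ler_sum => i _; rewrite ler_wpM2l // ge_min lexx.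
have -> : (\sum_i a i * x i - 3) / 2 = \sum_i a i * ((x i - 3) / 2).
  under [RHS]eq_bigr do rewrite mulrA mulrBr.
  by rewrite -mulr_suml sumrB -mulr_suml a1 mul1r.
by apply: ler_sum => i _; rewrite ler_wpM2l // ge_min lexx orbT.
Qed.

(** The depth counter plays the same part as in [message_fuel]; [cmsgE] is the
    recursion that matters. *)
Fixpoint cmsg_fuel (C : T -> rat) (n : nat) (v p : T) : rat :=
  if n is n'.+1 then
    phi (C v + \sum_(u | e v u && (u != p)) cmsg_fuel C n' u v)
  else 0.

Definition cmsg C v p := cmsg_fuel C #|T| v p.

Definition cscore C v : rat := C v + \sum_(u | e v u) cmsg C u v.

Lemma cmsg_fuel_stable C v p : e v p -> forall m n,
  (#|branch e v p| <= m)%N -> (#|branch e v p| <= n)%N ->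
  cmsg_fuel C m v p = cmsg_fuel C n v p.
Proof.
have B0 x y : (0 < #|branch e x y|)%N.
  by apply/card_gt0P; exists x; exact: branch_self.
move: v p; apply: branch_ind => v p evp IH [|m] [|n];
  try by move: (B0 v p); rewrite ltnNge => /negP.
move=> lm ln; congr phi; congr (_ + _); apply: eq_bigr => u /andP[evu up].
have lt := proper_card (branch_proper treP evp evu up).
by apply: IH; rewrite // -ltnS; apply: leq_trans lt _.
Qed.

Lemma cmsgE C v p : e v p ->
  cmsg C v p = phi (C v + \sum_(u | e v u && (u != p)) cmsg C u v).
Proof.
move=> evp; rewrite /cmsg (@cmsg_fuel_stable _ _ _ _ #|T| #|T|.+1) ?max_card //.
exact: leqW (max_card _).
Qed.

Lemma cscore_split C v u : e v u ->
  cscore C v =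
  C v + \sum_(w | e v w && (w != u)) cmsg C w v + cmsg C u v.
Proof. by move=> evu; rewrite /cscore (bigD1 u) //= addrCA addrC. Qed.

(** Across an edge, each of the two scores is [x + phi y] where [x] and [y]
    are what the two ends would hold without the message over that edge. *)
Lemma cscore_adj C u v : e u v -> cscore C u <= 0 -> cscore C v <= 0.
Proof.
move=> euv; have evu : e v u by rewrite esym.
rewrite (cscore_split _ euv) (cscore_split _ evu) !cmsgE //.
exact: phi_swap.
Qed.

Lemma cscore_reroot C u v : cscore C u <= 0 -> cscore C v <= 0.
Proof.
case/connectP: (conn u v) => s ps ->; elim: s u ps => //= w s IHs u.
by move=> /andP[euw ps] /(cscore_adj euw); apply: IHs.
Qed.

(** Concavity and monotonicity in the configuration at once: allowing [D] to
    lie above the convex combination avoids equalities between functions. *)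
Lemma cmsg_concave (I : finType) (a : I -> rat) (C : I -> T -> rat) D v p :
  (forall i, 0 <= a i) -> \sum_i a i = 1 ->
  (forall x, \sum_i a i * C i x <= D x) -> e v p ->
  \sum_i a i * cmsg (C i) v p <= cmsg D v p.
Proof.
move=> a0 a1 leD; move: v p; apply: branch_ind => v p evp IH.
rewrite cmsgE //; under eq_bigr do rewrite cmsgE //.
apply: le_trans (phi_concave _ a0 a1) (phi_mono _).
under eq_bigr do rewrite mulrDr mulr_sumr.
rewrite big_split exchange_big /= lerD //.
by apply: ler_sum => u /andP[evu up]; apply: IH.
Qed.

Lemma cscore_concave (I : finType) (a : I -> rat) (C : I -> T -> rat) D v :
  (forall i, 0 <= a i) -> \sum_i a i = 1 ->
  (forall x, \sum_i a i * C i x <= D x) ->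
  \sum_i a i * cscore (C i) v <= cscore D v.
Proof.
move=> a0 a1 leD; rewrite /cscore.
under eq_bigr do rewrite mulrDr mulr_sumr.
rewrite big_split exchange_big /= lerD //.
by apply: ler_sum => u evu; apply: cmsg_concave; rewrite // esym.
Qed.

(** * Filling the leaves *)

Definition leaf v : nat := deg e v == 1.

Lemma deg_gt0 v p : e v p -> (0 < deg e v)%N.
Proof. by move=> evp; apply/card_gt0P; exists p; rewrite inE. Qed.

(** Messages increase with the configuration, so the leaf units alone give the
    lowest value; wherever the rest of the mass lies, the bound persists. *)
Lemma cmsg_ge_cost C v p :
  (forall x, (leaf x)%:R <= C x) -> e v p -> - (cost v p)%:R <= cmsg C v p.
Proof.
move=> leC; move: v p; apply: branch_ind => v p evp IH; rewrite cmsgE //.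
have [dv|dv] := ltnP 1 (deg e v).
  have sum_ge : - (\sum_(u | e v u && (u != p)) cost u v)%:R <=
      C v + \sum_(u | e v u && (u != p)) cmsg C u v.
    rewrite natr_sum -sumrN -[leLHS]add0r lerD //.
      by apply: le_trans (leC v); rewrite ler0n.
    by apply: ler_sum => u /andP[evu up]; apply: IH.
  apply: le_trans (phi_mono sum_ge).
  have := cost_step evp dv; rewrite -(ler_nat rat) natrD natrM.
  have : 0 <= (\sum_(u | e v u && (u != p)) cost u v)%:R :> rat by rewrite ler0n.
  by move=> sum0 step; rewrite phi_low; lra.
have dv1 : deg e v = 1%N by apply/eqP; rewrite eqn_leq dv (deg_gt0 evp).
have C1 : 1 <= C v + \sum_(u | e v u && (u != p)) cmsg C u v.
  rewrite big_pred0 ?addr0; first by have := leC v; rewrite /leaf dv1.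
  by move=> u; apply/negP => /andP[evu]; rewrite (leaf_neighbor dv1 evu evp) eqxx.
apply: le_trans (phi_mono C1).
have : 1 <= (cost v p)%:R :> rat by rewrite ler1n.
by rewrite phi_low //; lra.
Qed.

Definition pad (C : T -> nat) (v : T) : nat := maxn (C v) (leaf v).

Lemma branch_occupied C v p u :
  e v p -> e v u -> u != p -> occupied e C u v -> occupied e C v p.
Proof.
move=> evp evu up /existsP[w /andP[wu Cw]]; apply/existsP; exists w.
by rewrite Cw (subsetP (branch_sub evp evu up)).
Qed.

(** An empty branch contributes 0 to the true score; filling its leaves makes
    it ask for mass, so it contributes no more than that to the concave one. *)
Lemma cmsg_pad_empty C v p :
  e v p -> ~~ occupied e C v p -> cmsg (fun x => (pad C x)%:R) v p <= 0.
Proof.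
move: v p; apply: branch_ind => v p evp IH empty; rewrite cmsgE //.
have /eqP Cv : C v == 0%N.
  apply: contraNT empty => Cv; apply/existsP; exists v.
  by rewrite branch_self.
have le1 : (pad C v)%:R + \sum_(u | e v u && (u != p))
    cmsg (fun x => (pad C x)%:R) u v <= 1 :> rat.
  rewrite -[leRHS]addr0 lerD //.
    by rewrite /pad Cv max0n lern1 /leaf; case: eqP.
  apply: sumr_le0 => u /andP[evu up]; apply: IH => //.
  by apply: contra empty; exact: branch_occupied.
by apply: le_trans (phi_mono le1) _; rewrite phi_low //; lra.
Qed.

Lemma pad_nonzero C v : C v != 0%N -> pad C v = C v.
Proof.
by rewrite -lt0n => Cv; apply/maxn_idPl; apply: leq_trans (leq_b1 _) Cv.
Qed.

Lemma cmsg_pad_le_message C v p :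
  e v p -> cmsg (fun x => (pad C x)%:R) v p <= (message_bar e C v p)%:~R.
Proof.
move: v p; apply: branch_ind => v p evp IH; rewrite /message_bar.
case: ifPn => [occ|/(cmsg_pad_empty evp) //].
rewrite (message_rec C treP evp) cmsgE //; apply: phi_le_F.
rewrite rmorphD rmorph_sum /= lerD //.
  have [Cv|Cv] := eqVneq (C v) 0%N; last by rewrite pad_nonzero.
  rewrite /pad Cv max0n /leaf; case: eqP => // dv1.
  case/existsP: occ => w /andP[/(leaf_branch evp dv1) ->].
  by rewrite Cv.
rewrite [leRHS](eq_bigl (fun u => (e v u && (u != p)) && occupied e C u v));
  last by move=> u; rewrite andbA.
rewrite [leRHS]big_mkcondr; apply: ler_sum => u /andP[evu up].
by have := IH u evu up; rewrite /message_bar; case: ifP.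
Qed.

(** The hypothesis [C r != 0] ensures that padding leaves the content of [r]
    unchanged even when [r] is a leaf. *)
Lemma cscore_pad_le C r :
  C r != 0%N -> cscore (fun x => (pad C x)%:R) r <= (score e C r)%:~R.
Proof.
move=> Cr; rewrite /cscore /score rmorphD rmorph_sum /= pad_nonzero // lerD2l.
by apply: ler_sum => u eru; apply: cmsg_pad_le_message; rewrite esym.
Qed.

(** * Reduction to a single pile *)

Definition pile (m : rat) (w x : T) : rat := (leaf x)%:R + m * (x == w)%:R.

(** [C] is the convex combination of the piles at all [w], with weights
    proportional to the excess of [C] over the leaf units. *)
Lemma exists_pile (C : T -> rat) r :
  (forall x, (leaf x)%:R <= C x) -> cscore C r <= 0 ->
  exists w, cscore (pile (\sum_x (C x - (leaf x)%:R)) w) r <= 0.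
Proof.
move=> leC Sr; have exc_ge0 x : 0 <= C x - (leaf x)%:R by rewrite subr_ge0.
have [m sum_exc] : {m | \sum_x (C x - (leaf x)%:R) = m} by eexists.
have m_ge0 : 0 <= m by rewrite -sum_exc sumr_ge0.
rewrite sum_exc.
have [a [a0 a1 aC]] : exists a : T -> rat, [/\ forall w, 0 <= a w,
    \sum_w a w = 1 & forall x, \sum_w a w * pile m w x <= C x].
  have [m0|m_neq0] := eqVneq m 0.
    (* Without excess all piles coincide, and any weights will do. *)
    exists (fun w => (w == r)%:R); split=> [w||x]; first by rewrite ler0n.
      by rewrite (bigD1 r) //= eqxx big1 ?addr0 // => w /negPf ->.
    rewrite (bigD1 r) //= eqxx big1 => [|w /negPf ->]; last by rewrite mul0r.
    by rewrite /pile m0 mul0r !addr0 mul1r.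
  have sum_a : \sum_w (C w - (leaf w)%:R) / m = 1.
    by rewrite -mulr_suml sum_exc divff.
  exists (fun w => (C w - (leaf w)%:R) / m); split=> // [w|x].
    by rewrite divr_ge0.
  rewrite /pile; under eq_bigr do rewrite mulrDr.
  rewrite big_split /= -mulr_suml sum_a mul1r (bigD1 x) //= eqxx mulr1.
  rewrite big1 => [|w wx]; last by rewrite eq_sym (negPf wx) !mulr0.
  by rewrite divfK // addr0 addrC subrK.
have /forallPn/= [w Sw] : ~~ [forall w, 0 < cscore (pile m w) r].
  apply/negP => /forallP pos.
  have := le_trans (cscore_concave r a0 a1 aC) Sr.
  rewrite leNgt => /negP; apply.
  have terms_ge0 w : true -> 0 <= a w * cscore (pile m w) r.
    by move=> _; rewrite mulr_ge0 // ltW.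
  rewrite lt_def sumr_ge0 // andbT; apply/eqP => /(psumr_eq0P terms_ge0) z.
  have az w : true -> a w = 0.
    move=> _; have /eqP := z w isT; rewrite mulf_eq0 => /orP[/eqP // | /eqP S_0].
    by have := pos w; rewrite S_0 ltxx.
  by move: a1; rewrite big1.
by exists w; rewrite leNgt.
Qed.

Lemma pile_bound m w : 0 <= m -> cscore (pile m w) w <= 0 ->
  m + (\sum_x leaf x)%:R <= (estim_at e w)%:R - 1.
Proof.
move=> m0; rewrite /cscore /pile eqxx mulr1.
set S := \sum_(u | _) _ => Sw.
have S_ge : - (\sum_(u | e w u) cost u w)%:R <= S.
  rewrite natr_sum -sumrN; apply: ler_sum => u ewu.
  apply: cmsg_ge_cost; last by rewrite esym.
  by move=> x; rewrite lerDl mulr_ge0.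
have ellE : (\sum_x leaf x = leaf w + ell e w)%N.
  rewrite (bigD1 w) //=; congr addn.
  rewrite /ell -sum1dep_card [RHS]big_mkcondr /=.
  by apply: eq_bigr => x _; rewrite /leaf; case: eqP.
rewrite ellE /estim_at; have := sum_cost_lt_sigma w.
rewrite -(ler_nat rat) -natr1 !natrD; lra.
Qed.

Lemma mass_lt_estim (C : T -> nat) :
  (forall v, score e C v <= 0) -> (mass C < estim e)%N.
Proof.
move=> S0; have [r _] : exists r : T, r \in T by apply/card_gt0P; case: treP.
have [/existsP[s Cs]|/existsPn C0] := boolP [exists s, C s != 0%N]; last first.
  rewrite /mass big1 => [|v _]; last by apply/eqP; rewrite -[_ == _]negbK C0.
  by apply: leq_trans (leq_bigmax r); rewrite /estim_at /sigma.
pose D x : rat := (pad C x)%:R.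
have leD x : (leaf x)%:R <= D x by rewrite ler_nat leq_maxr.
have SD : cscore D s <= 0.
  by apply: le_trans (cscore_pad_le Cs) _; rewrite lerz0.
have [w Sw] := exists_pile leD SD; move: (@cscore_reroot _ _ w Sw).
set m := \sum_x _ => /pile_bound.
have m0 : 0 <= m by apply: sumr_ge0 => x _; rewrite subr_ge0.
have mE : m + (\sum_x leaf x)%:R = (\sum_x pad C x)%:R.
  by rewrite /m sumrB !natr_sum subrK.
move=> /(_ m0); rewrite mE lerBrDr natr1 ler_nat => ltw.
apply: leq_trans (leq_bigmax w); apply: leq_trans ltw; rewrite ltnS.
by apply: leq_sum => x _; exact: leq_maxl.
Qed.

End Tree.

Theorem theorem5p11 (T : finType) (e : rel T) (C : T -> nat) :
  is_tree e -> (1 < #|T|)%N ->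
  (forall v : T, score e C v <= 0) ->
  (mass C)%:Z <= (estim e)%:Z - 1.
Proof.
move=> treP _ S0; have := mass_lt_estim treP S0; lia.
Qed.
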